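(* Let $r$ be a positive integer and let $F_m$ denote the $m$-th Fibonacci number ($F_1=F_2=1$, $F_{m+2}=F_{m+1}+F_m$). If $r$ is odd, then $b_4\big([(1\;2)^{\lceil r/2\rceil}]_4\big)=F_{r+3}$. If $r$ is even, then $b_4\big([(1\;2)^{r/2}\;2]_4\big)=F_{r+3}$. In both cases, $F_{r+3}$ is the maximal value of $b_4(n)$ over integers $n$ in the interval $$\Big[-[\underbrace{1\;1\;\cdots\;1}_{r+1}]_4,\;[\underbrace{1\;1\;\cdots\;1}_{r+2}]_4\Big].$$
   Context: For an integer $n$, a balanced quaternary representation of $n$ is an expression $n=\sum_{i\ge 0}\epsilon_i 4^i$ with finitely many nonzero $\epsilon_i$ and all $\epsilon_i\in\{-2,-1,0,1,2\}$ (representations differing only by leading zeros are identified); $b_4(n)$ denotes the number of such representations. Notation: $[\epsilon_k\;\cdots\;\epsilon_0]_4=\sum_{i=0}^k\epsilon_i4^i$; $[\underbrace{1\;\cdots\;1}_{m}]_4$ denotes the string of $m$ ones; $(1\;2)^t$ denotes the digit block $1\;2$ repeated $t$ times, e.g. $[(1\;2)^2]_4=[1\;2\;1\;2]_4$ and $[(1\;2)^{1}\;2]_4=[1\;2\;2]_4$. *)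

(* Defs.v *)
From mathcomp Require Import all_boot all_order all_algebra.
From mathcomp Require Import finmap zify.
From mathcomp Require Import boolp classical_sets functions cardinality.

Set Implicit Arguments.
Unset Strict Implicit.
Unset Printing Implicit Defensive.

Import Order.TTheory GRing.Theory Num.Theory.
Local Open Scope ring_scope.

Definition digits : seq int := [:: -2; -1; 0; 1; 2].

(* A digit sequence (e_i)_(i >= 0) with finitely many nonzero terms is encoded
   as the polynomial \sum_i e_i 'X^i: its i-th term is p`_i, for every i, and
   sequences differing only by leading zeros are the same polynomial. *)
Definition balanced_quaternary (n : int) (p : {poly int}) : Prop :=
  (forall i : nat, p`_i \in digits) /\
  n = \sum_(i < size p) p`_i * 4 ^+ i.

Definition representations (n : int) : set {poly int} :=
  [set p | balanced_quaternary n p]%classic.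

(* fset_set maps infinite sets to the empty set; this case does not arise here,
   by finite_representations below. *)
Definition b4 (n : int) : nat := #|` fset_set (representations n) |%fset.

(* The value of a string of digits, most significant digit first, as in
   [e_k ... e_0]_4. *)
Definition quaternary (s : seq int) : int :=
  \sum_(i < size s) (rev s)`_i * 4 ^+ i.

Definition repeat_block (t : nat) (w : seq int) : seq int :=
  flatten (nseq t w).

Fixpoint fib (m : nat) : nat :=
  match m with
  | 0 => 0
  | 1 => 1
  | (m'.+1 as k).+1 => (fib k + fib m')%N
  end.

Definition is_max_on (f : int -> nat) (a b : int) (M : nat) : Prop :=
  (exists2 n : int, a <= n <= b & f n = M) /\
  (forall n : int, a <= n <= b -> (f n <= M)%N).

Lemma representation_size (n : int) (p : {poly int}) :
  balanced_quaternary n p -> (size p <= `|n|)%N.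
Proof.
case=> + ->; rewrite -horner_coef.
elim/poly_ind: p => [|p c IH] dP; first by rewrite size_poly0.
have dp i : p`_i \in digits.
  by have := dP i.+1; rewrite coefD coefMX coefC /= addr0.
have dc : c \in digits by have := dP 0%N; rewrite coefD coefMX coefC /= add0r.
have {IH dp dP} := IH dp.
rewrite -cons_poly_def size_cons_poly horner_cons nil_poly.
have [->|p0] := eqVneq p 0.
  rewrite size_poly0 horner0 mul0r add0r => _ /=.
  by case: eqVneq => //= c0; move: c0; lia.
rewrite /=; rewrite -size_poly_eq0 in p0.
move: dc; rewrite !inE => dc sp; move: p0 sp dc.
move: (size p) p.[4] => k x; lia.
Qed.

Lemma finite_representations (n : int) : finite_set (representations n).
Proof.
pose f (g : {ffun 'I_`|n| -> 'I_5}) : {poly int} :=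
  \poly_(i < `|n|) (if insub i is Some j then digits`_(g j) else 0).
apply: (@sub_finite_set _ _ (f @` setT)%classic); last first.
  exact/finite_image/finite_finset.
move=> p pP; have sp := representation_size pP; case: pP => dp _.
have ip (i : nat) : (index (p`_i)%R digits < 5)%N.
  by rewrite -[5%N]/(size digits) index_mem.
exists [ffun j : 'I_`|n| => Ordinal (ip j)] => //.
apply/polyP => i; rewrite coef_poly; case: ltnP => [lt_in|le_ni].
  by rewrite insubT ffunE /= nth_index.
by rewrite nth_default // (leq_trans sp).
Qed.

(* Main.v *)
(** Splitting off the last digit [d] of a representation of [n] leaves a
    representation of [(n - d) / 4].  The digit is determined by [n] unless
    [n = 4m + 2], where it is [2] or [-2]; hence [b4 (4m) = b4 (4m +- 1) = b4 m]
    and [b4 (4m + 2) = b4 m + b4 (m + 1)].  Two consecutive integers are never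
    both congruent to 2 modulo 4, so a bound on [b4 n] and a bound on
    [b4 n + b4 (n + 1)] by consecutive Fibonacci numbers can be proved together,
    by induction on the length of the interval; the strings [(1 2)^t] and
    [(1 2)^t 2] attain equality at each step. *)
Require Import Defs.
From mathcomp Require Import all_boot all_order all_algebra.
From mathcomp Require Import finmap zify.
From mathcomp Require Import classical_sets cardinality.

Set Implicit Arguments.
Unset Strict Implicit.
Unset Printing Implicit Defensive.

Import Order.TTheory GRing.Theory Num.Theory.
Local Open Scope ring_scope.

Definition append_digit (d : int) (p : {poly int}) : {poly int} :=
  p * 'X + d%:P.

Lemma coef_append_digit d p i :
  (append_digit d p)`_i = if i is j.+1 then p`_j else d.
Proof. by rewrite coefD coefMX coefC; case: i => [|i]; rewrite ?add0r ?addr0. Qed.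

Lemma append_digit_inj d : injective (append_digit d).
Proof.
by move=> p q pq; apply/polyP => i; have := congr1 (fun u : {poly int} => u`_i.+1) pq;
  rewrite !coef_append_digit.
Qed.

Lemma representations_append_digit (n : int) p :
  representations n p <->
  exists d m : int, [/\ d \in digits, n = 4 * m + d &
    (append_digit d @` representations m)%classic p].
Proof.
rewrite /representations /= /balanced_quaternary -horner_coef; split.
  elim/poly_ind: p => [|p c _] [dp ->].
    (* The zero polynomial has no last digit to remove; it is the digit [0] appended to itself. *)
    exists 0, 0; split; rewrite ?horner0 //.
    exists 0; last by rewrite /append_digit mul0r addr0.
    by split=> [i|]; rewrite ?coef0 // size_poly0 big_ord0.
  have dpE := coef_append_digit c p; rewrite /append_digit in dpE.
  exists c, p.[4]; split; first by have := dp 0%N; rewrite dpE.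
    by rewrite !hornerE mulrC.
  exists p => //; split=> [i|]; first by have := dp i.+1; rewrite dpE.
  by rewrite horner_coef.
case=> d [m [dd -> [q [dq ->] <-]]]; split=> [i|].
  by rewrite coef_append_digit; case: i.
by rewrite -horner_coef !hornerE mulrC.
Qed.

Lemma card_append_digit d m :
  #|` fset_set (append_digit d @` representations m)%classic |%fset = b4 m.
Proof.
rewrite fset_set_image; last exact: finite_representations.
by rewrite card_imfset //; apply: append_digit_inj.
Qed.

Lemma b4_0 : b4 0 = 1%N.
Proof.
rewrite /b4 (_ : representations 0 = [set 0]%classic) ?fset_set1 ?cardfs1 //.
apply/seteqP; split=> p.
  by move=> /representation_size; rewrite leqn0 size_poly_eq0 => /eqP.
move=> ->; split; first by move=> i; rewrite coef0.
by rewrite size_poly0 big_ord0.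
Qed.

(** A digit differs from [d] by at most 3, so being congruent to [d] modulo 4 forces equality. *)
Lemma b4_unique_digit (d m : int) : d \in [:: -1; 0; 1] -> b4 (4 * m + d) = b4 m.
Proof.
move=> d3; rewrite -(card_append_digit d m) /b4.
congr (#|` fset_set _ |%fset); apply/seteqP; split=> p.
  move=> /representations_append_digit [e [k [e5 dk kp]]].
  move: d3 e5; rewrite !inE => d3 e5.
  by have [-> ->] : d = e /\ m = k by lia.
move=> mp; apply/representations_append_digit; exists d, m; split=> //.
by move: d3; rewrite !inE; lia.
Qed.

Lemma b4_two_digits (m : int) : b4 (4 * m + 2) = (b4 m + b4 (m + 1))%N.
Proof.
rewrite -(card_append_digit 2 m) -(card_append_digit (-2) (m + 1)) -cardfsUI.
rewrite -fset_setU; try exact/finite_image/finite_representations.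
rewrite -fset_setI; try exact/finite_image/finite_representations.
(* The two images are disjoint, since their polynomials have constant terms [2] and [-2]. *)
rewrite [X in (_ + #|` fset_set X |%fset)%N](_ : _ = set0).
  rewrite fset_set0 cardfs0 addn0 /b4.
  congr (#|` fset_set _ |%fset); apply/seteqP; split=> p.
    move=> /representations_append_digit [d [k []]]; rewrite !inE => d5 mk kp.
    have : (d = 2 /\ k = m) \/ (d = -2 /\ k = m + 1) by lia.
    by case=> -[dE kE]; subst d k; [left|right].
  case=> mp; apply/representations_append_digit.
    by exists 2, m.
  by exists (-2), (m + 1); split=> //; lia.
apply/seteqP; split=> // p [[q _ <-] [q' _]] /(congr1 (fun u : {poly int} => u`_0)).
by rewrite !coef_append_digit.
Qed.

Definition ones (k : nat) : int := quaternary (nseq k 1).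

Lemma quaternary_rcons (s : seq int) (d : int) : quaternary (rcons s d) = 4 * quaternary s + d.
Proof.
rewrite /quaternary size_rcons big_ord_recl rev_rcons /= mulr1 addrC mulr_sumr.
by congr (_ + _); apply: eq_bigr => i _; rewrite exprS mulrCA.
Qed.

Lemma ones_0 : ones 0 = 0.
Proof. exact: big_ord0. Qed.

Lemma ones_succ k : ones k.+1 = 4 * ones k + 1.
Proof.
by rewrite /ones -quaternary_rcons -cats1 -[[:: 1]]/(nseq 1 1) -nseqD addn1.
Qed.

(** The symmetric interval suits the induction: if [4 * m + d] lies in the one for [k.+1], then [m]
    lies in the one for [k], and so does [m + 1] when [d = 2]. *)
Lemma b4_le_fib k :
  (forall n : int, - ones k <= n <= ones k -> (b4 n <= fib k.+1)%N) /\
  (forall n : int, - ones k <= n -> n + 1 <= ones k ->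
    (b4 n + b4 (n + 1) <= fib k.+2)%N).
Proof.
elim: k => [|k [IH1 IH2]].
  (* For [k = 0] the interval is a single point and contains no consecutive pair. *)
  rewrite ones_0; split=> n; last by lia.
  by move=> n0; rewrite (_ : n = 0) ?b4_0 //; lia.
have fibSS j : fib j.+2 = (fib j.+1 + fib j)%N by [].
rewrite ones_succ.
have mod4 (n : int) : exists m : int, [\/ n = 4 * m, n = 4 * m + 1, n = 4 * m + 2 | n = 4 * m - 1].
  (* Adding 1 before dividing makes the remainders run from -1 to 2. *)
  have : (n = 4 * ((n + 1) %/ 4)%Z - 1) \/ (n = 4 * ((n + 1) %/ 4)%Z) \/
    (n = 4 * ((n + 1) %/ 4)%Z + 1) \/ (n = 4 * ((n + 1) %/ 4)%Z + 2) by lia.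
  move: (_ %/ _)%Z => m nE; exists m.
  by case: nE => [|[|[|]]] ->; [constructor 4|constructor 1|constructor 2|constructor 3].
have b4_4 (m : int) : b4 (4 * m) = b4 m by rewrite -[4 * m]addr0 b4_unique_digit.
have b4_1 (m : int) : b4 (4 * m + 1) = b4 m by rewrite b4_unique_digit.
have b4_3 (m : int) : b4 (4 * m - 1) = b4 m by rewrite b4_unique_digit.
split=> n.
  have [m [] -> n_int] := mod4 n; rewrite ?b4_4 ?b4_1 ?b4_3 ?b4_two_digits.
  - by have := IH1 m; rewrite fibSS; lia.
  - by have := IH1 m; rewrite fibSS; lia.
  - by apply: IH2; lia.
  - by have := IH1 m; rewrite fibSS; lia.
(* A pair containing [4 * m + 2] contributes [b4 m + b4 (m + 1)] plus one of these two terms; any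
   other pair contributes only [2 * b4 m]. *)
have [m [] -> n_ge n_le] := mod4 n; rewrite ?b4_4 ?b4_1 ?b4_3 ?b4_two_digits.
- by have := IH1 m; rewrite !fibSS; lia.
- rewrite (_ : 4 * m + 1 + 1 = 4 * m + 2); last by lia.
  by rewrite b4_two_digits; have := IH1 m; have := IH2 m; rewrite !fibSS; lia.
- rewrite (_ : 4 * m + 2 + 1 = 4 * (m + 1) - 1); last by lia.
  by rewrite b4_3; have := IH1 (m + 1); have := IH2 m; rewrite !fibSS; lia.
- rewrite (_ : 4 * m - 1 + 1 = 4 * m); last by lia.
  by rewrite b4_4; have := IH1 m; rewrite !fibSS; lia.
Qed.

Definition block12 (t : nat) : int := quaternary (repeat_block t [:: 1; 2]).

Lemma block12_0 : block12 0 = 0.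
Proof. exact: big_ord0. Qed.

Lemma block12_succ t : block12 t.+1 = 4 * (4 * block12 t + 1) + 2.
Proof.
rewrite -!quaternary_rcons -!cats1 -catA /block12 /repeat_block.
by rewrite -addn1 nseqD flatten_cat.
Qed.

(** Both values are carried along because [block12 t.+1] splits into [4 * block12 t + 1] and
    [4 * block12 t + 2]. *)
Lemma b4_block12 t :
  b4 (block12 t) = fib (t.*2 + 2) /\ b4 (4 * block12 t + 2) = fib (t.*2 + 3).
Proof.
elim: t => [|t [IH1 IH2]].
  rewrite block12_0; split; first exact: b4_0.
  by rewrite b4_two_digits -[0 + 1]/(4 * 0 + 1) b4_unique_digit // b4_0.
have E : b4 (block12 t.+1) = fib (t.+1.*2 + 2).
  rewrite block12_succ b4_two_digits b4_unique_digit //.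
  rewrite (_ : 4 * block12 t + 1 + 1 = 4 * block12 t + 2); last by lia.
  by rewrite IH1 IH2 doubleS !addnS !addn0 addnC.
split=> //; rewrite b4_two_digits E block12_succ.
rewrite (_ : _ + 2 + 1 = 4 * (4 * block12 t + 2) - 1); last by lia.
by rewrite b4_unique_digit // IH2 doubleS !addnS !addn0.
Qed.

(** Strictness matters for even [r]: it gives [4 * block12 t + 2 <= 4 * ones t.*2.+1 + 1]. *)
Lemma block12_bounds t : 0 <= block12 t < ones t.*2.+1.
Proof.
elim: t => [|t IH]; last by rewrite block12_succ doubleS !ones_succ in IH *; lia.
by rewrite ones_succ ones_0 block12_0.
Qed.

Theorem theorem1p4 (r : nat) (r_gt0 : (0 < r)%N) :
  [/\ odd r ->
        b4 (quaternary (repeat_block (uphalf r) [:: 1; 2])) = fib (r + 3),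
      ~~ odd r ->
        b4 (quaternary (repeat_block r./2 [:: 1; 2] ++ [:: 2])) = fib (r + 3)
    & is_max_on b4 (- quaternary (nseq r.+1 1)) (quaternary (nseq r.+2 1))
        (fib (r + 3))].
Proof.
have odd_r : odd r ->
    b4 (quaternary (repeat_block (uphalf r) [:: 1; 2])) = fib (r + 3).
  move=> r_odd; have [+ _] := b4_block12 (uphalf r); rewrite /block12 => ->.
  by congr fib; lia.
have even_r : ~~ odd r ->
    b4 (quaternary (repeat_block r./2 [:: 1; 2] ++ [:: 2])) = fib (r + 3).
  move=> r_even; rewrite cats1 quaternary_rcons.
  have [_ +] := b4_block12 r./2; rewrite /block12 => ->.
  by congr fib; lia.
have ones_ge0 k : 0 <= ones k.
  by elim: k => [|k IH]; rewrite ?ones_0 ?ones_succ; lia.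
rewrite -/(ones r.+1) -/(ones r.+2).
split=> //; split; last first.
  (* The given interval is contained in the symmetric one for [r.+2], as
     [ones r.+1 <= ones r.+2]. *)
  move=> n n_int; rewrite addn3; apply: (b4_le_fib r.+2).1.
  by have := ones_ge0 r.+1; have := ones_succ r.+1; lia.
have [r_odd | r_even] := boolP (odd r).
  exists (quaternary (repeat_block (uphalf r) [:: 1; 2])); last exact: odd_r.
  have := block12_bounds (uphalf r); rewrite (_ : _.*2.+1 = r.+2); last by lia.
  by rewrite /block12; have := ones_ge0 r.+1; lia.
exists (quaternary (repeat_block r./2 [:: 1; 2] ++ [:: 2])); last exact: even_r.
have := block12_bounds r./2; rewrite (_ : _.*2.+1 = r.+1); last by lia.
rewrite cats1 quaternary_rcons (ones_succ r.+1) /block12.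
by have := ones_ge0 r.+1; lia.
Qed.
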